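(* Let $f(x,y,y')$ be a smooth function and consider the scalar second-order ODE $y''=f(x,y,y')$. This ODE is linearizable via a point transformation $$t=\phi(x,y),\qquad u=\psi(x,y),\qquad J=\phi_x\psi_y-\phi_y\psi_x\neq 0,$$ if and only if the following holds. The ODE has the form $$y''+F_3(x,y)\,{y'}^3+F_2(x,y)\,{y'}^2+F_1(x,y)\,y'+F(x,y)=0,$$ and there exist (auxiliary) functions $w(x,y)$, $z(x,y)$ and functions $\phi(x,y)$, $\psi(x,y)$ with $\phi_x\psi_y-\phi_y\psi_x\neq0$ such that (i) the ODE admits the $\lambda$-symmetries equivalent to the canonical pair $\left(\frac{\partial}{\partial y},\lambda_1\right)$ with $$\lambda_1=-F_3\,{y'}^{2}-\left(F_2-w\right)y'-z;$$ (ii) both $S=\phi$ and $S=\psi$ satisfy the over-determined system $$\begin{aligned} S_{yy}+(2w-F_2)\,S_y+F_3\,S_x&=0,\\ S_{xy}+w\,S_x-z\,S_y&=0,\\ S_{xx}+(F_1-2z)\,S_x-F\,S_y&=0. \end{aligned}$$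
   Context: All functions are smooth and everything is local in $(x,y)$: $f$ is defined on $U\times\mathbb{R}$ with $U$ a neighbourhood of a given point $(x_0,y_0)\in\mathbb{R}^2$, and the functions $F_3,F_2,F_1,F,w,z,\phi,\psi$ of $(x,y)$ are defined on a (possibly smaller) neighbourhood of $(x_0,y_0)$, with $\phi_x\psi_y-\phi_y\psi_x$ nowhere zero there. Subscripts $x,y$ denote partial derivatives. Linearizable via point transformations: the ODE $y''=f(x,y,y')$ is linearizable via point transformations if there is a point transformation $t=\phi(x,y)$, $u=\psi(x,y)$ with $J=\phi_x\psi_y-\phi_y\psi_x\ne0$ under which it corresponds to the free particle equation $u_{tt}=0$. That is, near $(x_0,y_0)$, the equation $u_{tt}=0$, where $u_t=\frac{\psi_x+\psi_y y'}{\phi_x+\phi_y y'}$ and $u_{tt}=\frac{D_x(u_t)}{\phi_x+\phi_y y'}$ with $D_x=\partial_x+y'\partial_y+y''\partial_{y'}$, is equivalent to $y''=f(x,y,y')$ wherever $\phi_x+\phi_y y'\neq0$. (Every linear second-order ODE can be transformed to $u_{tt}=0$ by a point transformation.) $\lambda$-symmetries: for the ODE $y''=f(x,y,y')$ put $A=\partial_x+y'\partial_y+f\,\partial_{y'}$. For a smooth function $\lambda(x,y,y')$, the pair $\left(\frac{\partial}{\partial y},\lambda\right)$ is a $\lambda$-symmetry of the ODE if and only if $$\lambda_x+y'\lambda_y+f\,\lambda_{y'}+\lambda^2=f_y+\lambda\,f_{y'}$$ identically in $(x,y,y')$. A general pair $(v,\lambda)$ with $v=\xi(x,y)\partial_x+\eta(x,y)\partial_y$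 and characteristic $Q=\eta-\xi y'\not\equiv0$ is equivalent to the canonical pair $\left(\frac{\partial}{\partial y},\lambda+\frac{A(Q)}{Q}\right)$: one is a $\lambda$-symmetry of the ODE if and only if the other is. Hence ''the ODE admits the $\lambda$-symmetries equivalent to the canonical pair $\left(\frac{\partial}{\partial y},\lambda_1\right)$'' means that $\left(\frac{\partial}{\partial y},\lambda_1\right)$ is a $\lambda$-symmetry of the ODE. *)

(* Defs.v *)
From Stdlib Require Export Reals.
From Coquelicot Require Export Coquelicot.
Open Scope R_scope.

(* Functions are total; all hypotheses and conclusions about them are restricted
   to an open set of base points (x,y).  The third variable p stands for y', the
   fourth variable q for y''. *)

(* [ex_diff_n g n x y]: all iterated partial derivatives of g at (x,y) of order
   at most n exist and are jointly continuous there.  On an open set, requiring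
   this for every n at every point is the C^infinity condition. *)
Definition smooth2 (V : R * R -> Prop) (g : R -> R -> R) : Prop :=
  forall (n : nat) (x y : R), V (x, y) -> ex_diff_n g n x y.

Definition d_x (g : R -> R -> R -> R) (x y p : R) : R := Derive (fun t => g t y p) x.
Definition d_y (g : R -> R -> R -> R) (x y p : R) : R := Derive (fun t => g x t p) y.
Definition d_p (g : R -> R -> R -> R) (x y p : R) : R := Derive (fun t => g x y t) p.

Fixpoint ex_diff3_n (g : R -> R -> R -> R) (n : nat) (x y p : R) : Prop :=
  continuous (fun a : R * R * R => g (fst (fst a)) (snd (fst a)) (snd a)) (x, y, p) /\
  match n with
  | O => True
  | S m =>
      ex_derive (fun t => g t y p) x /\
      ex_derive (fun t => g x t p) y /\
      ex_derive (fun t => g x y t) p /\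
      ex_diff3_n (d_x g) m x y p /\
      ex_diff3_n (d_y g) m x y p /\
      ex_diff3_n (d_p g) m x y p
  end.

Definition smooth3 (V : R * R -> Prop) (g : R -> R -> R -> R) : Prop :=
  forall (n : nat) (x y p : R), V (x, y) -> ex_diff3_n g n x y p.

Definition open_nbhd_in (U V : R * R -> Prop) (x0 y0 : R) : Prop :=
  open V /\ V (x0, y0) /\ (forall a : R * R, V a -> U a).

Definition jacobian (phi psi : R -> R -> R) (x y : R) : R :=
  partial_derive 1 0 phi x y * partial_derive 0 1 psi x y
  - partial_derive 0 1 phi x y * partial_derive 1 0 psi x y.

Definition point_transformation (V : R * R -> Prop) (phi psi : R -> R -> R) : Prop :=
  smooth2 V phi /\ smooth2 V psi /\
  forall x y : R, V (x, y) -> jacobian phi psi x y <> 0.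

(* The operator d/dx + y' d/dy + y'' d/dy' applied to g. *)
Definition total_derivative (g : R -> R -> R -> R) (x y p q : R) : R :=
  d_x g x y p + p * d_y g x y p + q * d_p g x y p.

Definition first_total (g : R -> R -> R) (x y p : R) : R :=
  partial_derive 1 0 g x y + partial_derive 0 1 g x y * p.

Definition u_t (phi psi : R -> R -> R) (x y p : R) : R :=
  first_total psi x y p / first_total phi x y p.

Definition u_tt (phi psi : R -> R -> R) (x y p q : R) : R :=
  total_derivative (u_t phi psi) x y p q / first_total phi x y p.

Definition linearizable (U : R * R -> Prop) (x0 y0 : R) (f : R -> R -> R -> R) : Prop :=
  exists (V : R * R -> Prop) (phi psi : R -> R -> R),
    open_nbhd_in U V x0 y0 /\
    point_transformation V phi psi /\
    (forall x y p q : R, V (x, y) -> first_total phi x y p <> 0 ->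
       (u_tt phi psi x y p q = 0 <-> q = f x y p)).

Definition A_field (f g : R -> R -> R -> R) (x y p : R) : R :=
  total_derivative g x y p (f x y p).

(* Determining equation for (d/dy, lambda) to be a lambda-symmetry of y'' = f on V x R. *)
Definition lambda_symmetry (V : R * R -> Prop) (f lambda : R -> R -> R -> R) : Prop :=
  smooth3 V lambda /\
  forall x y p : R, V (x, y) ->
    A_field f lambda x y p + (lambda x y p) ^ 2
    = d_y f x y p + lambda x y p * d_p f x y p.

Definition cubic_form (V : R * R -> Prop) (f : R -> R -> R -> R)
    (F3 F2 F1 F : R -> R -> R) : Prop :=
  forall x y p q : R, V (x, y) ->
    (q = f x y p <->
     q + F3 x y * p ^ 3 + F2 x y * p ^ 2 + F1 x y * p + F x y = 0).

Definition lambda1 (F3 F2 w z : R -> R -> R) (x y p : R) : R :=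
  - F3 x y * p ^ 2 - (F2 x y - w x y) * p - z x y.

Definition overdetermined_system (V : R * R -> Prop)
    (F3 F2 F1 F w z S : R -> R -> R) : Prop :=
  forall x y : R, V (x, y) ->
    partial_derive 0 2 S x y + (2 * w x y - F2 x y) * partial_derive 0 1 S x y
      + F3 x y * partial_derive 1 0 S x y = 0 /\
    partial_derive 1 1 S x y + w x y * partial_derive 1 0 S x y
      - z x y * partial_derive 0 1 S x y = 0 /\
    partial_derive 2 0 S x y + (F1 x y - 2 * z x y) * partial_derive 1 0 S x y
      - F x y * partial_derive 0 1 S x y = 0.

(* Main.v *)
From Stdlib Require Import Lra.
Require Import Defs.

(** In the coordinates [t = phi], [u = psi] the derivative [u_tt] is
    [J / (D phi)^3] times [y''] plus a cubic in [y'], where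
    [D phi = phi_x + phi_y y'] and the coefficients of the cubic are built from
    the second derivatives of [phi] and [psi]
    (e.g. [F = (phi_x psi_xx - psi_x phi_xx) / J]).  The over-determined system is
    this fact in disguise: since [phi] and [psi] have independent gradients, its
    second equation for both of them is a linear system for [w] and [z], which
    Cramer's rule solves, and with these [w], [z] the two other equations say
    exactly that [F3], [F2], [F1], [F] are the coefficients of the cubic
    ([overdetermined_system_exists] and [overdetermined_system_u_tt]).

    So if the system holds, [u_tt = 0] is equivalent to the cubic equation where
    [D phi] does not vanish, and the equation is linearizable.  Conversely, a
    linearizing transformation gives the coefficients by Cramer's rule, and
    [f] is minus the cubic where [D phi] does not vanish.  For a given [(x, y)]
    this excludes at most one slope [y'], and continuity of [f] recovers it
    ([linearizing_cubic_form]).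

    The lambda-symmetry comes from integrability.  The system expresses the second
    derivatives of [S] through the first ones, that is, it says that [dS] is
    parallel for a linear connection on covectors.  Two independent parallel
    covectors force the curvature to vanish, which is equality of the third mixed
    derivatives of [S] ([flat_connection]).  In the determining equation for
    [lambda1] the powers of [y'] above the second cancel identically, and the
    three remaining coefficients are combinations of the curvature components
    ([overdetermined_system_lambda_symmetry]). *)

(** * Smooth functions of two variables *)

Lemma open_locally_2d (V : R * R -> Prop) (x y : R) :
  open V -> V (x, y) -> locally_2d (fun u v => V (u, v)) x y.
Proof.
intros oV Vxy. apply locally_2d_locally.
apply filter_imp with (2 := oV _ Vxy). now intros [u v].
Qed.

Lemma open_locally_x (V : R * R -> Prop) (x y : R) :
  open V -> V (x, y) -> locally x (fun t => V (t, y)).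
Proof.
intros oV Vxy. apply (locally_2d_1d_const_y (fun u v => V (u, v))).
now apply open_locally_2d.
Qed.

Lemma open_locally_y (V : R * R -> Prop) (x y : R) :
  open V -> V (x, y) -> locally y (fun t => V (x, t)).
Proof.
intros oV Vxy. apply (locally_2d_1d_const_x (fun u v => V (u, v))).
now apply open_locally_2d.
Qed.

Definition ex_diff_on (V : R * R -> Prop) (n : nat) (g : R -> R -> R) : Prop :=
  forall x y : R, V (x, y) -> ex_diff_n g n x y.

Lemma ex_diff_on_le (V : R * R -> Prop) (m n : nat) (g : R -> R -> R) :
  (m <= n)%nat -> ex_diff_on V n g -> ex_diff_on V m g.
Proof. intros lemn Dg x y Vxy. apply (ex_diff_n_m n m lemn). now apply Dg. Qed.

Lemma ex_diff_on_ext (V : R * R -> Prop) (n : nat) (f g : R -> R -> R) :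
  open V -> (forall x y, V (x, y) -> f x y = g x y) ->
  ex_diff_on V n f -> ex_diff_on V n g.
Proof.
intros oV fg Df x y Vxy.
apply ex_diff_n_ext_loc with (2 := Df x y Vxy).
destruct (open_locally_2d V x y oV Vxy) as [e He].
exists e. intros u v Hu Hv. apply fg. now apply He.
Qed.

(** Inductive step for all closure properties below: it suffices to know formulas
    for the partial derivatives on [V], because [ex_diff_n] only sees their germs. *)
Lemma ex_diff_on_S (V : R * R -> Prop) (n : nat) (g gx gy : R -> R -> R) :
  open V ->
  (forall x y, V (x, y) -> continuity_2d_pt g x y) ->
  (forall x y, V (x, y) -> is_derive (fun t => g t y) x (gx x y)) ->
  (forall x y, V (x, y) -> is_derive (fun t => g x t) y (gy x y)) ->
  ex_diff_on V n gx -> ex_diff_on V n gy -> ex_diff_on V (S n) g.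
Proof.
intros oV Cg Hx Hy Dx Dy.
assert (Ex : ex_diff_on V n (partial_derive 1 0 g)).
{ apply (ex_diff_on_ext V n gx); trivial.
  intros x y Vxy. symmetry. apply is_derive_unique. now apply Hx. }
assert (Ey : ex_diff_on V n (partial_derive 0 1 g)).
{ apply (ex_diff_on_ext V n gy); trivial.
  intros x y Vxy. symmetry. apply is_derive_unique. now apply Hy. }
intros x y Vxy. split; [now apply Cg|].
split; [eexists; now apply Hx|].
split; [eexists; now apply Hy|].
split; [exact (Ex x y Vxy)|exact (Ey x y Vxy)].
Qed.

Lemma ex_diff_on_continuity (V : R * R -> Prop) (n : nat) (g : R -> R -> R) :
  ex_diff_on V n g -> forall x y, V (x, y) -> continuity_2d_pt g x y.
Proof. intros Dg x y Vxy. now destruct n; apply (Dg x y Vxy). Qed.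

Lemma ex_diff_on_is_derive_x (V : R * R -> Prop) (n : nat) (g : R -> R -> R) :
  ex_diff_on V (S n) g -> forall x y, V (x, y) ->
  is_derive (fun t => g t y) x (partial_derive 1 0 g x y).
Proof. intros Dg x y Vxy. apply Derive_correct. apply (Dg x y Vxy). Qed.

Lemma ex_diff_on_is_derive_y (V : R * R -> Prop) (n : nat) (g : R -> R -> R) :
  ex_diff_on V (S n) g -> forall x y, V (x, y) ->
  is_derive (fun t => g x t) y (partial_derive 0 1 g x y).
Proof. intros Dg x y Vxy. apply Derive_correct. apply (Dg x y Vxy). Qed.

Lemma ex_diff_on_dx (V : R * R -> Prop) (n : nat) (g : R -> R -> R) :
  ex_diff_on V (S n) g -> ex_diff_on V n (partial_derive 1 0 g).
Proof. intros Dg x y Vxy. exact (proj1 (proj2 (proj2 (proj2 (Dg x y Vxy))))). Qed.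

Lemma ex_diff_on_dy (V : R * R -> Prop) (n : nat) (g : R -> R -> R) :
  ex_diff_on V (S n) g -> ex_diff_on V n (partial_derive 0 1 g).
Proof. intros Dg x y Vxy. exact (proj2 (proj2 (proj2 (proj2 (Dg x y Vxy))))). Qed.

Lemma ex_diff_on_const (V : R * R -> Prop) (n : nat) (c : R) :
  open V -> ex_diff_on V n (fun _ _ => c).
Proof.
intros oV. revert c. induction n as [|n IH]; intros c.
- intros x y _. split; trivial. apply continuity_2d_pt_const.
- apply ex_diff_on_S with (fun _ _ => 0) (fun _ _ => 0); trivial;
    intros; try apply continuity_2d_pt_const;
    exact (is_derive_const (K := R_AbsRing) (V := R_NormedModule) c _).
Qed.

Lemma ex_diff_on_plus (V : R * R -> Prop) (n : nat) (f g : R -> R -> R) :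
  open V -> ex_diff_on V n f -> ex_diff_on V n g ->
  ex_diff_on V n (fun x y => f x y + g x y).
Proof.
intros oV. revert f g. induction n as [|n IH]; intros f g Df Dg.
- intros x y Vxy. split; trivial.
  apply continuity_2d_pt_plus; eapply ex_diff_on_continuity; eauto.
- apply ex_diff_on_S with
    (fun x y => partial_derive 1 0 f x y + partial_derive 1 0 g x y)
    (fun x y => partial_derive 0 1 f x y + partial_derive 0 1 g x y); trivial;
    intros.
  + apply continuity_2d_pt_plus; eapply ex_diff_on_continuity; eauto.
  + apply (is_derive_plus (V := R_NormedModule) (fun t => f t y) (fun t => g t y));
      eapply ex_diff_on_is_derive_x; eauto.
  + apply (is_derive_plus (V := R_NormedModule) (fun t => f x t) (fun t => g x t));
      eapply ex_diff_on_is_derive_y; eauto.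
  + apply IH; now apply ex_diff_on_dx.
  + apply IH; now apply ex_diff_on_dy.
Qed.

Lemma is_derive_Rmult (f g : R -> R) (x df dg : R) :
  is_derive f x df -> is_derive g x dg ->
  is_derive (fun t => f t * g t) x (df * g x + f x * dg).
Proof.
intros Hf Hg. apply (is_derive_mult f g x df dg Hf Hg).
intros a b. apply Rmult_comm.
Qed.

Lemma ex_diff_on_mult (V : R * R -> Prop) (n : nat) (f g : R -> R -> R) :
  open V -> ex_diff_on V n f -> ex_diff_on V n g ->
  ex_diff_on V n (fun x y => f x y * g x y).
Proof.
intros oV. revert f g. induction n as [|n IH]; intros f g Df Dg.
- intros x y Vxy. split; trivial.
  apply continuity_2d_pt_mult; eapply ex_diff_on_continuity; eauto.
- assert (Df' : ex_diff_on V n f) by (revert Df; apply ex_diff_on_le; auto).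
  assert (Dg' : ex_diff_on V n g) by (revert Dg; apply ex_diff_on_le; auto).
  apply ex_diff_on_S with
    (fun x y => partial_derive 1 0 f x y * g x y + f x y * partial_derive 1 0 g x y)
    (fun x y => partial_derive 0 1 f x y * g x y + f x y * partial_derive 0 1 g x y);
    trivial; intros.
  + apply continuity_2d_pt_mult; eapply ex_diff_on_continuity; eauto.
  + apply (is_derive_Rmult (fun t => f t y) (fun t => g t y));
      eapply ex_diff_on_is_derive_x; eauto.
  + apply (is_derive_Rmult (fun t => f x t) (fun t => g x t));
      eapply ex_diff_on_is_derive_y; eauto.
  + apply ex_diff_on_plus; trivial; apply IH; trivial; now apply ex_diff_on_dx.
  + apply ex_diff_on_plus; trivial; apply IH; trivial; now apply ex_diff_on_dy.
Qed.

(** The gradient of [1/g] is the gradient of [g] times [-(1/g)^2], so the order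
    of differentiability of [1/g] bootstraps from that of [g]. *)
Lemma ex_diff_on_inv (V : R * R -> Prop) (n : nat) (g : R -> R -> R) :
  open V -> (forall x y, V (x, y) -> g x y <> 0) ->
  ex_diff_on V n g -> ex_diff_on V n (fun x y => / g x y).
Proof.
intros oV g0. induction n as [|n IH]; intros Dg.
- intros x y Vxy. split; trivial.
  apply continuity_2d_pt_inv; [eapply ex_diff_on_continuity|]; eauto.
- assert (Di : ex_diff_on V n (fun x y => / g x y)).
  { apply IH. revert Dg; apply ex_diff_on_le; auto. }
  apply ex_diff_on_S with
    (fun x y => partial_derive 1 0 g x y * (-1 * (/ g x y * / g x y)))
    (fun x y => partial_derive 0 1 g x y * (-1 * (/ g x y * / g x y))); trivial.
  + intros x y Vxy.
    apply continuity_2d_pt_inv; [eapply ex_diff_on_continuity|]; eauto.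
  + intros x y Vxy.
    replace (partial_derive 1 0 g x y * (-1 * (/ g x y * / g x y)))
      with (- partial_derive 1 0 g x y / g x y ^ 2) by (field; auto).
    apply (is_derive_inv (fun t => g t y)); auto.
    eapply ex_diff_on_is_derive_x; eauto.
  + intros x y Vxy.
    replace (partial_derive 0 1 g x y * (-1 * (/ g x y * / g x y)))
      with (- partial_derive 0 1 g x y / g x y ^ 2) by (field; auto).
    apply (is_derive_inv (fun t => g x t)); auto.
    eapply ex_diff_on_is_derive_y; eauto.
  + apply ex_diff_on_mult; trivial; [now apply ex_diff_on_dx|].
    apply ex_diff_on_mult; trivial; [now apply ex_diff_on_const|].
    now apply ex_diff_on_mult.
  + apply ex_diff_on_mult; trivial; [now apply ex_diff_on_dy|].
    apply ex_diff_on_mult; trivial; [now apply ex_diff_on_const|].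
    now apply ex_diff_on_mult.
Qed.

Lemma smooth2_const (V : R * R -> Prop) (c : R) :
  open V -> smooth2 V (fun _ _ => c).
Proof. intros oV n. now apply ex_diff_on_const. Qed.

Lemma smooth2_mult (V : R * R -> Prop) (f g : R -> R -> R) :
  open V -> smooth2 V f -> smooth2 V g -> smooth2 V (fun x y => f x y * g x y).
Proof. intros oV Sf Sg n. apply ex_diff_on_mult; trivial; red; auto. Qed.

Lemma smooth2_opp (V : R * R -> Prop) (g : R -> R -> R) :
  open V -> smooth2 V g -> smooth2 V (fun x y => - g x y).
Proof.
intros oV Sg n.
apply (ex_diff_on_ext V n (fun x y => -1 * g x y)); trivial.
{ intros; ring. }
apply ex_diff_on_mult; [trivial|now apply ex_diff_on_const|red; auto].
Qed.

Lemma smooth2_plus (V : R * R -> Prop) (f g : R -> R -> R) :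
  open V -> smooth2 V f -> smooth2 V g -> smooth2 V (fun x y => f x y + g x y).
Proof. intros oV Sf Sg n. apply ex_diff_on_plus; trivial; red; auto. Qed.

Lemma smooth2_minus (V : R * R -> Prop) (f g : R -> R -> R) :
  open V -> smooth2 V f -> smooth2 V g -> smooth2 V (fun x y => f x y - g x y).
Proof. intros oV Sf Sg. apply smooth2_plus; trivial. now apply smooth2_opp. Qed.

Lemma smooth2_div (V : R * R -> Prop) (f g : R -> R -> R) :
  open V -> (forall x y, V (x, y) -> g x y <> 0) ->
  smooth2 V f -> smooth2 V g -> smooth2 V (fun x y => f x y / g x y).
Proof.
intros oV g0 Sf Sg. apply smooth2_mult; trivial.
intros n. apply ex_diff_on_inv; trivial. red; auto.
Qed.

Lemma smooth2_dx (V : R * R -> Prop) (g : R -> R -> R) :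
  smooth2 V g -> smooth2 V (partial_derive 1 0 g).
Proof. intros Sg n. apply ex_diff_on_dx. red; auto. Qed.

Lemma smooth2_dy (V : R * R -> Prop) (g : R -> R -> R) :
  smooth2 V g -> smooth2 V (partial_derive 0 1 g).
Proof. intros Sg n. apply ex_diff_on_dy. red; auto. Qed.

Lemma smooth2_dxx (V : R * R -> Prop) (g : R -> R -> R) :
  smooth2 V g -> smooth2 V (partial_derive 2 0 g).
Proof. intros Sg. now apply (smooth2_dx V (partial_derive 1 0 g)), smooth2_dx. Qed.

Lemma smooth2_dxy (V : R * R -> Prop) (g : R -> R -> R) :
  smooth2 V g -> smooth2 V (partial_derive 1 1 g).
Proof. intros Sg. now apply (smooth2_dx V (partial_derive 0 1 g)), smooth2_dy. Qed.

Lemma smooth2_dyy (V : R * R -> Prop) (g : R -> R -> R) :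
  smooth2 V g -> smooth2 V (partial_derive 0 2 g).
Proof. intros Sg. now apply (smooth2_dy V (partial_derive 0 1 g)), smooth2_dy. Qed.

Lemma smooth2_is_derive_x (V : R * R -> Prop) (g : R -> R -> R) (x y : R) :
  smooth2 V g -> V (x, y) ->
  is_derive (fun t => g t y) x (partial_derive 1 0 g x y).
Proof. intros Sg. apply (ex_diff_on_is_derive_x V 0). red; auto. Qed.

Lemma smooth2_is_derive_y (V : R * R -> Prop) (g : R -> R -> R) (x y : R) :
  smooth2 V g -> V (x, y) ->
  is_derive (fun t => g x t) y (partial_derive 0 1 g x y).
Proof. intros Sg. apply (ex_diff_on_is_derive_y V 0). red; auto. Qed.

Lemma smooth2_schwarz (V : R * R -> Prop) (g : R -> R -> R) (x y : R) :
  open V -> smooth2 V g -> V (x, y) ->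
  partial_derive 0 1 (partial_derive 1 0 g) x y = partial_derive 1 1 g x y.
Proof.
intros oV Sg Vxy. symmetry. apply (Schwarz g).
- destruct (open_locally_2d V x y oV Vxy) as [e He].
  exists e. intros u v Hu Hv. assert (Vuv := He u v Hu Hv).
  split; [|split; [|split]]; eexists.
  + eapply smooth2_is_derive_x; eauto.
  + eapply smooth2_is_derive_y; eauto.
  + eapply (smooth2_is_derive_x V (partial_derive 0 1 g)); trivial.
    now apply smooth2_dy.
  + eapply (smooth2_is_derive_y V (partial_derive 1 0 g)); trivial.
    now apply smooth2_dx.
- apply (smooth2_dx V _ (smooth2_dy V _ Sg) 0%nat x y Vxy).
- apply (smooth2_dy V _ (smooth2_dx V _ Sg) 0%nat x y Vxy).
Qed.

Lemma smooth2_is_derive_dx_y (V : R * R -> Prop) (g : R -> R -> R) (x y : R) :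
  open V -> smooth2 V g -> V (x, y) ->
  is_derive (fun t => partial_derive 1 0 g x t) y (partial_derive 1 1 g x y).
Proof.
intros oV Sg Vxy. rewrite <- (smooth2_schwarz V); trivial.
apply (smooth2_is_derive_y V); trivial. now apply smooth2_dx.
Qed.

Lemma smooth2_is_derive_dy_x (V : R * R -> Prop) (g : R -> R -> R) (x y : R) :
  smooth2 V g -> V (x, y) ->
  is_derive (fun t => partial_derive 0 1 g t y) x (partial_derive 1 1 g x y).
Proof.
intros Sg Vxy. apply (smooth2_is_derive_x V (partial_derive 0 1 g)); trivial.
now apply smooth2_dy.
Qed.

Lemma smooth2_is_derive_dx_x (V : R * R -> Prop) (g : R -> R -> R) (x y : R) :
  smooth2 V g -> V (x, y) ->
  is_derive (fun t => partial_derive 1 0 g t y) x (partial_derive 2 0 g x y).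
Proof.
intros Sg Vxy. apply (smooth2_is_derive_x V (partial_derive 1 0 g)); trivial.
now apply smooth2_dx.
Qed.

Lemma smooth2_is_derive_dy_y (V : R * R -> Prop) (g : R -> R -> R) (x y : R) :
  smooth2 V g -> V (x, y) ->
  is_derive (fun t => partial_derive 0 1 g x t) y (partial_derive 0 2 g x y).
Proof.
intros Sg Vxy. apply (smooth2_is_derive_y V (partial_derive 0 1 g)); trivial.
now apply smooth2_dy.
Qed.

(** * Smooth functions of [x], [y] and [y'] *)

Definition ex_diff3_on (V : R * R -> Prop) (n : nat) (g : R -> R -> R -> R) : Prop :=
  forall x y p : R, V (x, y) -> ex_diff3_n g n x y p.

Definition continuous3 (g : R -> R -> R -> R) (x y p : R) : Prop :=
  continuous (fun a : R * R * R => g (fst (fst a)) (snd (fst a)) (snd a)) (x, y, p).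

Lemma ex_diff3_on_ext (V : R * R -> Prop) (n : nat) (f g : R -> R -> R -> R) :
  open V -> (forall x y p, V (x, y) -> f x y p = g x y p) ->
  ex_diff3_on V n f -> ex_diff3_on V n g.
Proof.
intros oV. revert f g.
assert (C : forall f g x y p, (forall u v q, V (u, v) -> f u v q = g u v q) ->
  V (x, y) -> continuous3 f x y p -> continuous3 g x y p).
{ intros f g x y p fg Vxy Cf.
  apply continuous_ext_loc with (2 := Cf).
  apply (filter_imp (fun a : R * R * R => V (fst a))).
  - intros [[u v] q] Vuv; now apply fg.
  - exact (continuous_fst (x, y) p V (oV _ Vxy)). }
induction n as [|n IH]; intros f g fg Df x y p Vxy;
  assert (Cg : continuous3 g x y p)
    by (apply (C f); trivial; apply (Df x y p Vxy)).
- now split.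
- split; [exact Cg|].
  destruct (Df x y p Vxy) as [_ [Hx [Hy [Hp _]]]].
  split; [|split; [|split; [|split; [|split]]]].
  + apply ex_derive_ext_loc with (2 := Hx).
    apply filter_imp with (2 := open_locally_x V x y oV Vxy). intros; now apply fg.
  + apply ex_derive_ext_loc with (2 := Hy).
    apply filter_imp with (2 := open_locally_y V x y oV Vxy). intros; now apply fg.
  + apply ex_derive_ext with (2 := Hp). intros; now apply fg.
  + apply (IH (d_x f)); trivial.
    * clear - fg oV. intros x y p Vxy. apply Derive_ext_loc.
      apply filter_imp with (2 := open_locally_x V x y oV Vxy).
      intros; now apply fg.
    * intros u v q Vuv. apply (Df u v q Vuv).
  + apply (IH (d_y f)); trivial.
    * clear - fg oV. intros x y p Vxy. apply Derive_ext_loc.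
      apply filter_imp with (2 := open_locally_y V x y oV Vxy).
      intros; now apply fg.
    * intros u v q Vuv. apply (Df u v q Vuv).
  + apply (IH (d_p f)); trivial.
    * clear - fg. intros x y p Vxy. apply Derive_ext.
      intros; now apply fg.
    * intros u v q Vuv. apply (Df u v q Vuv).
Qed.

Lemma ex_diff3_on_S (V : R * R -> Prop) (n : nat) (g gx gy gp : R -> R -> R -> R) :
  open V ->
  (forall x y p, V (x, y) -> continuous3 g x y p) ->
  (forall x y p, V (x, y) -> is_derive (fun t => g t y p) x (gx x y p)) ->
  (forall x y p, V (x, y) -> is_derive (fun t => g x t p) y (gy x y p)) ->
  (forall x y p, V (x, y) -> is_derive (fun t => g x y t) p (gp x y p)) ->
  ex_diff3_on V n gx -> ex_diff3_on V n gy -> ex_diff3_on V n gp ->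
  ex_diff3_on V (S n) g.
Proof.
intros oV Cg Hx Hy Hp Dx Dy Dp x y p Vxy.
split; [now apply Cg|].
split; [eexists; now apply Hx|].
split; [eexists; now apply Hy|].
split; [eexists; now apply Hp|].
split; [|split].
- apply (ex_diff3_on_ext V n gx); trivial.
  intros u v q Vuv. symmetry. apply is_derive_unique. now apply Hx.
- apply (ex_diff3_on_ext V n gy); trivial.
  intros u v q Vuv. symmetry. apply is_derive_unique. now apply Hy.
- apply (ex_diff3_on_ext V n gp); trivial.
  intros u v q Vuv. symmetry. apply is_derive_unique. now apply Hp.
Qed.

Lemma ex_diff3_on_le_S (V : R * R -> Prop) (n : nat) (g : R -> R -> R -> R) :
  ex_diff3_on V (S n) g -> ex_diff3_on V n g.
Proof.
revert g. induction n as [|n IH]; intros g Dg x y p Vxy.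
- split; trivial. apply (Dg x y p Vxy).
- destruct (Dg x y p Vxy) as [C [Hx [Hy [Hp _]]]].
  split; [exact C|]. split; [exact Hx|]. split; [exact Hy|]. split; [exact Hp|].
  split; [|split]; apply IH; trivial; intros u v q Vuv; apply (Dg u v q Vuv).
Qed.

Lemma ex_diff3_on_continuous (V : R * R -> Prop) (n : nat) (g : R -> R -> R -> R) :
  ex_diff3_on V n g -> forall x y p, V (x, y) -> continuous3 g x y p.
Proof. intros Dg x y p Vxy. now destruct n; apply (Dg x y p Vxy). Qed.

Lemma ex_diff3_on_partials (V : R * R -> Prop) (n : nat) (g : R -> R -> R -> R) :
  ex_diff3_on V (S n) g ->
  ex_diff3_on V n (d_x g) /\ ex_diff3_on V n (d_y g) /\ ex_diff3_on V n (d_p g).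
Proof.
intros Dg. repeat split; intros x y p Vxy; apply (Dg x y p Vxy).
Qed.

Lemma ex_diff3_on_is_derive_x (V : R * R -> Prop) (n : nat) (g : R -> R -> R -> R) :
  ex_diff3_on V (S n) g -> forall x y p, V (x, y) ->
  is_derive (fun t => g t y p) x (d_x g x y p).
Proof. intros Dg x y p Vxy. apply Derive_correct. apply (Dg x y p Vxy). Qed.

Lemma ex_diff3_on_is_derive_y (V : R * R -> Prop) (n : nat) (g : R -> R -> R -> R) :
  ex_diff3_on V (S n) g -> forall x y p, V (x, y) ->
  is_derive (fun t => g x t p) y (d_y g x y p).
Proof. intros Dg x y p Vxy. apply Derive_correct. apply (Dg x y p Vxy). Qed.

Lemma ex_diff3_on_is_derive_p (V : R * R -> Prop) (n : nat) (g : R -> R -> R -> R) :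
  ex_diff3_on V (S n) g -> forall x y p, V (x, y) ->
  is_derive (fun t => g x y t) p (d_p g x y p).
Proof. intros Dg x y p Vxy. apply Derive_correct. apply (Dg x y p Vxy). Qed.

Lemma ex_diff3_on_const (V : R * R -> Prop) (n : nat) (c : R) :
  open V -> ex_diff3_on V n (fun _ _ _ => c).
Proof.
intros oV. revert c. induction n as [|n IH]; intros c.
- intros x y p _. split; trivial. apply continuous_const.
- apply ex_diff3_on_S with (fun _ _ _ => 0) (fun _ _ _ => 0) (fun _ _ _ => 0);
    trivial; intros; try apply continuous_const;
    exact (is_derive_const (K := R_AbsRing) (V := R_NormedModule) c _).
Qed.

Lemma ex_diff3_on_plus (V : R * R -> Prop) (n : nat) (f g : R -> R -> R -> R) :
  open V -> ex_diff3_on V n f -> ex_diff3_on V n g ->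
  ex_diff3_on V n (fun x y p => f x y p + g x y p).
Proof.
intros oV. revert f g.
assert (C : forall m f g, ex_diff3_on V m f -> ex_diff3_on V m g ->
  forall x y p, V (x, y) -> continuous3 (fun x y p => f x y p + g x y p) x y p).
{ intros m f g Df Dg x y p Vxy.
  apply (continuous_plus (V := R_NormedModule));
  [apply (ex_diff3_on_continuous V m f)|apply (ex_diff3_on_continuous V m g)]; trivial. }
induction n as [|n IH]; intros f g Df Dg.
- intros x y p Vxy. split; trivial. now apply (C 0%nat f g).
- destruct (ex_diff3_on_partials V n f Df) as [fx [fy fp]].
  destruct (ex_diff3_on_partials V n g Dg) as [gx [gy gp]].
  apply ex_diff3_on_S with (fun x y p => d_x f x y p + d_x g x y p)
    (fun x y p => d_y f x y p + d_y g x y p)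
    (fun x y p => d_p f x y p + d_p g x y p); auto.
  + now apply (C (S n)).
  + intros x y p Vxy.
    apply (is_derive_plus (V := R_NormedModule) (fun t => f t y p) (fun t => g t y p));
      now apply (ex_diff3_on_is_derive_x V n).
  + intros x y p Vxy.
    apply (is_derive_plus (V := R_NormedModule) (fun t => f x t p) (fun t => g x t p));
      now apply (ex_diff3_on_is_derive_y V n).
  + intros x y p Vxy.
    apply (is_derive_plus (V := R_NormedModule) (fun t => f x y t) (fun t => g x y t));
      now apply (ex_diff3_on_is_derive_p V n).
Qed.

Lemma ex_diff3_on_mult (V : R * R -> Prop) (n : nat) (f g : R -> R -> R -> R) :
  open V -> ex_diff3_on V n f -> ex_diff3_on V n g ->
  ex_diff3_on V n (fun x y p => f x y p * g x y p).
Proof.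
intros oV. revert f g.
assert (C : forall m f g, ex_diff3_on V m f -> ex_diff3_on V m g ->
  forall x y p, V (x, y) -> continuous3 (fun x y p => f x y p * g x y p) x y p).
{ intros m f g Df Dg x y p Vxy.
  apply (continuous_mult (K := R_AbsRing));
  [apply (ex_diff3_on_continuous V m f)|apply (ex_diff3_on_continuous V m g)]; trivial. }
induction n as [|n IH]; intros f g Df Dg.
- intros x y p Vxy. split; trivial. now apply (C 0%nat f g).
- destruct (ex_diff3_on_partials V n f Df) as [fx [fy fp]].
  destruct (ex_diff3_on_partials V n g Dg) as [gx [gy gp]].
  assert (Df' := ex_diff3_on_le_S V n f Df).
  assert (Dg' := ex_diff3_on_le_S V n g Dg).
  apply ex_diff3_on_S with
    (fun x y p => d_x f x y p * g x y p + f x y p * d_x g x y p)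
    (fun x y p => d_y f x y p * g x y p + f x y p * d_y g x y p)
    (fun x y p => d_p f x y p * g x y p + f x y p * d_p g x y p); trivial.
  + now apply (C (S n)).
  + intros x y p Vxy. apply (is_derive_Rmult (fun t => f t y p) (fun t => g t y p));
      now apply (ex_diff3_on_is_derive_x V n).
  + intros x y p Vxy. apply (is_derive_Rmult (fun t => f x t p) (fun t => g x t p));
      now apply (ex_diff3_on_is_derive_y V n).
  + intros x y p Vxy. apply (is_derive_Rmult (fun t => f x y t) (fun t => g x y t));
      now apply (ex_diff3_on_is_derive_p V n).
  + apply ex_diff3_on_plus; auto.
  + apply ex_diff3_on_plus; auto.
  + apply ex_diff3_on_plus; auto.
Qed.

Lemma ex_diff3_on_p (V : R * R -> Prop) (n : nat) :
  open V -> ex_diff3_on V n (fun _ _ p => p).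
Proof.
intros oV.
assert (C : forall x y p : R, continuous3 (fun _ _ p => p) x y p).
{ intros x y p. apply continuous_snd. }
destruct n as [|n].
- intros x y p _. split; trivial. apply C.
- apply ex_diff3_on_S with (fun _ _ _ => 0) (fun _ _ _ => 0) (fun _ _ _ => 1); auto;
    try (now apply ex_diff3_on_const).
  + intros x y p _. exact (is_derive_const (K := R_AbsRing) (V := R_NormedModule) p x).
  + intros x y p _. exact (is_derive_const (K := R_AbsRing) (V := R_NormedModule) p y).
  + intros x y p _. apply (is_derive_id (K := R_AbsRing)).
Qed.

(** Lifts functions of the base point to functions that do not depend on [y']. *)
Lemma ex_diff3_on_base (V : R * R -> Prop) (n : nat) (g : R -> R -> R) :
  open V -> ex_diff_on V n g -> ex_diff3_on V n (fun x y _ => g x y).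
Proof.
intros oV. revert g.
assert (C : forall m g, ex_diff_on V m g ->
  forall x y p, V (x, y) -> continuous3 (fun x y _ => g x y) x y p).
{ intros m g Dg x y p Vxy.
  apply (continuous_comp (V := prod_UniformSpace R_UniformSpace R_UniformSpace)
    (fun a : R * R * R => fst a) (fun b : R * R => g (fst b) (snd b))).
  - apply continuous_fst.
  - apply continuity_2d_pt_filterlim. now apply (ex_diff_on_continuity V m). }
induction n as [|n IH]; intros g Dg.
- intros x y p Vxy. split; trivial. now apply (C 0%nat).
- apply ex_diff3_on_S with (fun x y _ => partial_derive 1 0 g x y)
    (fun x y _ => partial_derive 0 1 g x y) (fun _ _ _ => 0); trivial.
  + now apply (C (S n)).
  + intros. eapply ex_diff_on_is_derive_x; eauto.
  + intros. eapply ex_diff_on_is_derive_y; eauto.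
  + intros x y p _.
    exact (is_derive_const (K := R_AbsRing) (V := R_NormedModule) (g x y) p).
  + apply IH. now apply ex_diff_on_dx.
  + apply IH. now apply ex_diff_on_dy.
  + now apply ex_diff3_on_const.
Qed.

Lemma smooth3_lambda1 (V : R * R -> Prop) (F3 F2 w z : R -> R -> R) :
  open V -> smooth2 V F3 -> smooth2 V F2 -> smooth2 V w -> smooth2 V z ->
  smooth3 V (lambda1 F3 F2 w z).
Proof.
intros oV S3 S2 Sw Sz n.
assert (Dp := ex_diff3_on_p V n oV).
apply (ex_diff3_on_ext V n
  (fun x y p => - F3 x y * (p * p) + (- (F2 x y - w x y) * p + - z x y))); trivial.
{ intros x y p _. unfold lambda1. ring. }
apply ex_diff3_on_plus; trivial; [|apply ex_diff3_on_plus; trivial].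
- apply (ex_diff3_on_mult V n (fun x y _ => - F3 x y)); trivial.
  + apply ex_diff3_on_base; trivial. exact (smooth2_opp V F3 oV S3 n).
  + now apply ex_diff3_on_mult.
- apply (ex_diff3_on_mult V n (fun x y _ => - (F2 x y - w x y))); trivial.
  apply ex_diff3_on_base; trivial.
  exact (smooth2_opp V _ oV (smooth2_minus V F2 w oV S2 Sw) n).
- apply ex_diff3_on_base; trivial. exact (smooth2_opp V z oV Sz n).
Qed.

(** * The transformed equation *)

Lemma is_derive_quotient (n d : R -> R) (t n' d' : R) :
  is_derive n t n' -> is_derive d t d' -> d t <> 0 ->
  Derive (fun s => n s / d s) t = (n' * d t - n t * d') / d t ^ 2.
Proof. intros Hn Hd d0. apply is_derive_unique. now apply is_derive_div. Qed.

Lemma is_derive_affine (a b : R -> R) (t a' b' p : R) :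
  is_derive a t a' -> is_derive b t b' ->
  is_derive (fun s => a s + b s * p) t (a' + b' * p).
Proof.
intros Ha Hb.
apply (is_derive_plus (V := R_NormedModule) a (fun s => b s * p)); trivial.
replace (b' * p) with (b' * p + b t * 0) by ring.
apply (is_derive_Rmult b (fun _ => p)); trivial.
exact (is_derive_const (K := R_AbsRing) (V := R_NormedModule) p t).
Qed.

(** The quotient rule applied to [u_t = D psi / D phi], where [second g] is
    [D (D g)], the second total derivative of [g] along a curve with [y' = p] and
    [y'' = q]. *)
Lemma u_tt_eq (V : R * R -> Prop) (phi psi : R -> R -> R) (x y p q : R) :
  open V -> smooth2 V phi -> smooth2 V psi -> V (x, y) ->
  first_total phi x y p <> 0 ->
  let second g := partial_derive 2 0 g x y + 2 * partial_derive 1 1 g x y * p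
                  + partial_derive 0 2 g x y * p ^ 2 + partial_derive 0 1 g x y * q in
  u_tt phi psi x y p q =
    (second psi * first_total phi x y p - first_total psi x y p * second phi)
    / first_total phi x y p ^ 3.
Proof.
intros oV Sphi Spsi Vxy D0 second.
assert (Ex : forall g, smooth2 V g -> is_derive (fun t => first_total g t y p) x
  (partial_derive 2 0 g x y + partial_derive 1 1 g x y * p)).
{ intros g Sg. apply is_derive_affine.
  - now apply (smooth2_is_derive_dx_x V).
  - now apply (smooth2_is_derive_dy_x V). }
assert (Ey : forall g, smooth2 V g -> is_derive (fun t => first_total g x t p) y
  (partial_derive 1 1 g x y + partial_derive 0 2 g x y * p)).
{ intros g Sg. apply is_derive_affine.
  - now apply (smooth2_is_derive_dx_y V).
  - now apply (smooth2_is_derive_dy_y V). }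
assert (Ep : forall g, is_derive (fun t => first_total g x y t) p
  (partial_derive 0 1 g x y)).
{ intros g. unfold first_total. auto_derive; [trivial|ring]. }
unfold u_tt, total_derivative, d_x, d_y, d_p, u_t.
rewrite (is_derive_quotient _ _ x _ _ (Ex psi Spsi) (Ex phi Sphi) D0).
rewrite (is_derive_quotient _ _ y _ _ (Ey psi Spsi) (Ey phi Sphi) D0).
rewrite (is_derive_quotient _ _ p _ _ (Ep psi) (Ep phi) D0).
unfold second. field. exact D0.
Qed.

(** Replacing the second derivatives of [phi] and [psi] by their values from the
    system, the terms with [w] or [z] cancel in each power of [p]; what
    remains has the Jacobian as a factor. *)
Lemma overdetermined_system_u_tt (V : R * R -> Prop)
  (F3 F2 F1 F w z phi psi : R -> R -> R) (x y p q : R) :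
  open V -> point_transformation V phi psi ->
  overdetermined_system V F3 F2 F1 F w z phi ->
  overdetermined_system V F3 F2 F1 F w z psi ->
  V (x, y) -> first_total phi x y p <> 0 ->
  (u_tt phi psi x y p q = 0 <->
   q + F3 x y * p ^ 3 + F2 x y * p ^ 2 + F1 x y * p + F x y = 0).
Proof.
intros oV [Sphi [Spsi J0]] Hphi Hpsi Vxy D0.
specialize (J0 x y Vxy).
destruct (Hphi x y Vxy) as [Pyy [Pxy Pxx]].
destruct (Hpsi x y Vxy) as [Qyy [Qxy Qxx]].
assert (E : u_tt phi psi x y p q = jacobian phi psi x y / first_total phi x y p ^ 3
  * (q + F3 x y * p ^ 3 + F2 x y * p ^ 2 + F1 x y * p + F x y)).
{ rewrite (u_tt_eq V phi psi x y p q oV Sphi Spsi Vxy D0).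
  cut (forall n d j k : R, d <> 0 -> n = j * k -> n / d ^ 3 = j / d ^ 3 * k).
  { intros H. apply H; trivial. unfold first_total, jacobian.
    replace (partial_derive 0 2 phi x y) with
      ((F2 x y - 2 * w x y) * partial_derive 0 1 phi x y
       - F3 x y * partial_derive 1 0 phi x y) by lra.
    replace (partial_derive 0 2 psi x y) with
      ((F2 x y - 2 * w x y) * partial_derive 0 1 psi x y
       - F3 x y * partial_derive 1 0 psi x y) by lra.
    replace (partial_derive 1 1 phi x y) with
      (z x y * partial_derive 0 1 phi x y - w x y * partial_derive 1 0 phi x y) by lra.
    replace (partial_derive 1 1 psi x y) with
      (z x y * partial_derive 0 1 psi x y - w x y * partial_derive 1 0 psi x y) by lra.
    replace (partial_derive 2 0 phi x y) with
      (F x y * partial_derive 0 1 phi x y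
       - (F1 x y - 2 * z x y) * partial_derive 1 0 phi x y) by lra.
    replace (partial_derive 2 0 psi x y) with
      (F x y * partial_derive 0 1 psi x y
       - (F1 x y - 2 * z x y) * partial_derive 1 0 psi x y) by lra.
    ring. }
  intros n d j k d0 ->. field. exact d0. }
rewrite E. split.
- intros H. apply Rmult_integral in H. destruct H as [H|H]; [exfalso|exact H].
  apply J0. replace (jacobian phi psi x y) with
    (jacobian phi psi x y / first_total phi x y p ^ 3 * first_total phi x y p ^ 3)
    by (field; exact D0).
  rewrite H. ring.
- intros ->. ring.
Qed.

(** * Integrability of the over-determined system *)

Lemma partial_derive_linear_comb (V : R * R -> Prop) (a b u v : R -> R -> R) (x y : R) :
  smooth2 V a -> smooth2 V b -> smooth2 V u -> smooth2 V v -> V (x, y) ->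
  partial_derive 1 0 (fun x y => a x y * u x y + b x y * v x y) x y =
    partial_derive 1 0 a x y * u x y + a x y * partial_derive 1 0 u x y
    + (partial_derive 1 0 b x y * v x y + b x y * partial_derive 1 0 v x y) /\
  partial_derive 0 1 (fun x y => a x y * u x y + b x y * v x y) x y =
    partial_derive 0 1 a x y * u x y + a x y * partial_derive 0 1 u x y
    + (partial_derive 0 1 b x y * v x y + b x y * partial_derive 0 1 v x y).
Proof.
intros Sa Sb Su Sv Vxy. split; apply is_derive_unique.
- apply (is_derive_plus (V := R_NormedModule)
    (fun t => a t y * u t y) (fun t => b t y * v t y)).
  + apply (is_derive_Rmult (fun t => a t y) (fun t => u t y));
      now apply (smooth2_is_derive_x V).
  + apply (is_derive_Rmult (fun t => b t y) (fun t => v t y));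
      now apply (smooth2_is_derive_x V).
- apply (is_derive_plus (V := R_NormedModule)
    (fun t => a x t * u x t) (fun t => b x t * v x t)).
  + apply (is_derive_Rmult (fun t => a x t) (fun t => u x t));
      now apply (smooth2_is_derive_y V).
  + apply (is_derive_Rmult (fun t => b x t) (fun t => v x t));
      now apply (smooth2_is_derive_y V).
Qed.

Lemma partial_derive_ext_on (V : R * R -> Prop) (g h : R -> R -> R) (x y : R) :
  open V -> (forall x y, V (x, y) -> g x y = h x y) -> V (x, y) ->
  partial_derive 1 0 g x y = partial_derive 1 0 h x y /\
  partial_derive 0 1 g x y = partial_derive 0 1 h x y.
Proof.
intros oV gh Vxy. split; apply Derive_ext_loc.
- apply (filter_imp (fun t => V (t, y))); [intros t Vt; now apply gh|now apply open_locally_x].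
- apply (filter_imp (fun t => V (x, t))); [intros t Vt; now apply gh|now apply open_locally_y].
Qed.

(** Schwarz's theorem for a function [g] whose gradient is known in the frame
    [u], [v]. *)
Lemma mixed_partial_linear_comb (V : R * R -> Prop) (a b c d g u v : R -> R -> R) (x y : R) :
  open V -> smooth2 V a -> smooth2 V b -> smooth2 V c -> smooth2 V d ->
  smooth2 V g -> smooth2 V u -> smooth2 V v ->
  (forall x y, V (x, y) -> partial_derive 1 0 g x y = a x y * u x y + b x y * v x y) ->
  (forall x y, V (x, y) -> partial_derive 0 1 g x y = c x y * u x y + d x y * v x y) ->
  V (x, y) ->
  partial_derive 0 1 a x y * u x y + a x y * partial_derive 0 1 u x y
    + (partial_derive 0 1 b x y * v x y + b x y * partial_derive 0 1 v x y) =
  partial_derive 1 0 c x y * u x y + c x y * partial_derive 1 0 u x y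
    + (partial_derive 1 0 d x y * v x y + d x y * partial_derive 1 0 v x y).
Proof.
intros oV Sa Sb Sc Sd Sg Su Sv Hx Hy Vxy.
destruct (partial_derive_linear_comb V a b u v x y Sa Sb Su Sv Vxy) as [_ <-].
destruct (partial_derive_linear_comb V c d u v x y Sc Sd Su Sv Vxy) as [<- _].
destruct (partial_derive_ext_on V _ _ x y oV Hx Vxy) as [_ <-].
destruct (partial_derive_ext_on V _ _ x y oV Hy Vxy) as [<- _].
now apply (smooth2_schwarz V).
Qed.

Lemma transversal_gradients (a b px py qx qy : R) :
  px * qy - py * qx <> 0 -> a * px + b * py = 0 -> a * qx + b * qy = 0 ->
  a = 0 /\ b = 0.
Proof.
intros J0 Hp Hq.
split; apply (Rmult_eq_reg_r (px * qy - py * qx)); trivial.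
- replace (a * (px * qy - py * qx)) with
    ((a * px + b * py) * qy - (a * qx + b * qy) * py) by ring.
  rewrite Hp, Hq. ring.
- replace (b * (px * qy - py * qx)) with
    ((a * qx + b * qy) * px - (a * px + b * py) * qx) by ring.
  rewrite Hp, Hq. ring.
Qed.

(** The functions [a], ..., [k] are the Christoffel symbols of a torsion-free
    connection for which [d phi] and [d psi] are parallel.  Equating
    [(S_xy)_y = (S_yy)_x] and [(S_xx)_y = (S_xy)_x] and eliminating second
    derivatives leaves linear relations between [S_x] and [S_y] whose coefficients,
    the curvature components, are the same for [phi] and [psi], hence vanish. *)
Lemma flat_connection (V : R * R -> Prop) (a b c d e k phi psi : R -> R -> R) (x y : R) :
  open V -> smooth2 V a -> smooth2 V b -> smooth2 V c -> smooth2 V d ->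
  smooth2 V e -> smooth2 V k -> point_transformation V phi psi ->
  (forall S, S = phi \/ S = psi -> forall x y, V (x, y) ->
     partial_derive 2 0 S x y =
       a x y * partial_derive 1 0 S x y + b x y * partial_derive 0 1 S x y /\
     partial_derive 1 1 S x y =
       c x y * partial_derive 1 0 S x y + d x y * partial_derive 0 1 S x y /\
     partial_derive 0 2 S x y =
       e x y * partial_derive 1 0 S x y + k x y * partial_derive 0 1 S x y) ->
  V (x, y) ->
  (partial_derive 0 1 c x y + d x y * e x y
     = partial_derive 1 0 e x y + e x y * a x y + k x y * c x y - c x y * c x y /\
   partial_derive 0 1 d x y + c x y * d x y
     = partial_derive 1 0 k x y + e x y * b x y) /\
  (partial_derive 0 1 a x y + b x y * e x y
     = partial_derive 1 0 c x y + d x y * c x y /\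
   partial_derive 0 1 b x y + a x y * d x y + b x y * k x y
     = partial_derive 1 0 d x y + c x y * b x y + d x y * d x y).
Proof.
intros oV Sa Sb Sc Sd Se Sk [Sphi [Spsi J0]] H Vxy. specialize (J0 x y Vxy).
assert (Ey : forall S, S = phi \/ S = psi ->
  (partial_derive 0 1 c x y + d x y * e x y + c x y * c x y
     - partial_derive 1 0 e x y - e x y * a x y - k x y * c x y)
    * partial_derive 1 0 S x y
  + (partial_derive 0 1 d x y + c x y * d x y
     - partial_derive 1 0 k x y - e x y * b x y)
    * partial_derive 0 1 S x y = 0).
{ intros S HS.
  assert (SS : smooth2 V S) by (destruct HS as [->| ->]; trivial).
  destruct (H S HS x y Vxy) as [Exx [Exy Eyy]].
  assert (M := mixed_partial_linear_comb V c d e k (partial_derive 0 1 S)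
    (partial_derive 1 0 S) (partial_derive 0 1 S) x y oV Sc Sd Se Sk
    (smooth2_dy V S SS) (smooth2_dx V S SS) (smooth2_dy V S SS)
    (fun u v Vuv => proj1 (proj2 (H S HS u v Vuv)))
    (fun u v Vuv => proj2 (proj2 (H S HS u v Vuv))) Vxy).
  rewrite (smooth2_schwarz V S x y oV SS Vxy) in M.
  change (partial_derive 0 1 (partial_derive 0 1 S) x y)
    with (partial_derive 0 2 S x y) in M.
  change (partial_derive 1 0 (partial_derive 1 0 S) x y)
    with (partial_derive 2 0 S x y) in M.
  change (partial_derive 1 0 (partial_derive 0 1 S) x y)
    with (partial_derive 1 1 S x y) in M.
  rewrite Exx, Exy, Eyy in M. apply Rminus_diag_eq in M. rewrite <- M. ring. }
assert (Ex : forall S, S = phi \/ S = psi ->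
  (partial_derive 0 1 a x y + b x y * e x y
     - partial_derive 1 0 c x y - d x y * c x y)
    * partial_derive 1 0 S x y
  + (partial_derive 0 1 b x y + a x y * d x y + b x y * k x y
     - partial_derive 1 0 d x y - c x y * b x y - d x y * d x y)
    * partial_derive 0 1 S x y = 0).
{ intros S HS.
  assert (SS : smooth2 V S) by (destruct HS as [->| ->]; trivial).
  destruct (H S HS x y Vxy) as [Exx [Exy Eyy]].
  assert (M := mixed_partial_linear_comb V a b c d (partial_derive 1 0 S)
    (partial_derive 1 0 S) (partial_derive 0 1 S) x y oV Sa Sb Sc Sd
    (smooth2_dx V S SS) (smooth2_dx V S SS) (smooth2_dy V S SS)
    (fun u v Vuv => proj1 (H S HS u v Vuv))
    (fun u v Vuv => eq_trans (smooth2_schwarz V S u v oV SS Vuv)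
                      (proj1 (proj2 (H S HS u v Vuv)))) Vxy).
  rewrite (smooth2_schwarz V S x y oV SS Vxy) in M.
  change (partial_derive 0 1 (partial_derive 0 1 S) x y)
    with (partial_derive 0 2 S x y) in M.
  change (partial_derive 1 0 (partial_derive 1 0 S) x y)
    with (partial_derive 2 0 S x y) in M.
  change (partial_derive 1 0 (partial_derive 0 1 S) x y)
    with (partial_derive 1 1 S x y) in M.
  rewrite Exx, Exy, Eyy in M. apply Rminus_diag_eq in M. rewrite <- M. ring. }
destruct (transversal_gradients _ _ _ _ _ _ J0
  (Ey phi (or_introl eq_refl)) (Ey psi (or_intror eq_refl))) as [Y1 Y2].
destruct (transversal_gradients _ _ _ _ _ _ J0
  (Ex phi (or_introl eq_refl)) (Ex psi (or_intror eq_refl))) as [X1 X2].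
repeat split; lra.
Qed.

(** * The lambda-symmetry *)

Lemma Derive_minus_scal (f g : R -> R) (t k f' g' : R) :
  is_derive f t f' -> is_derive g t g' ->
  Derive (fun s => f s - k * g s) t = f' - k * g'.
Proof.
intros Hf Hg. apply is_derive_unique.
apply (is_derive_minus (V := R_NormedModule) f (fun s => k * g s)); trivial.
now apply is_derive_scal.
Qed.

Lemma Derive_opp_cubic (a b c d : R -> R) (t p a' b' c' d' : R) :
  is_derive a t a' -> is_derive b t b' -> is_derive c t c' -> is_derive d t d' ->
  Derive (fun s => - (a s * p ^ 3 + b s * p ^ 2 + c s * p + d s)) t
  = - (a' * p ^ 3 + b' * p ^ 2 + c' * p + d').
Proof.
intros Ha Hb Hc Hd. apply is_derive_unique. auto_derive.
- repeat split; eexists; eassumption.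
- replace (Derive (fun s => a s) t) with a' by (symmetry; now apply is_derive_unique).
  replace (Derive (fun s => b s) t) with b' by (symmetry; now apply is_derive_unique).
  replace (Derive (fun s => c s) t) with c' by (symmetry; now apply is_derive_unique).
  replace (Derive (fun s => d s) t) with d' by (symmetry; now apply is_derive_unique).
  ring.
Qed.

Lemma Derive_quadratic (a b c d : R -> R) (t p a' b' c' d' : R) :
  is_derive a t a' -> is_derive b t b' -> is_derive c t c' -> is_derive d t d' ->
  Derive (fun s => - a s * p ^ 2 - (b s - c s) * p - d s) t
  = - a' * p ^ 2 - (b' - c') * p - d'.
Proof.
intros Ha Hb Hc Hd. apply is_derive_unique. auto_derive.
- repeat split; eexists; eassumption.
- replace (Derive (fun s => a s) t) with a' by (symmetry; now apply is_derive_unique).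
  replace (Derive (fun s => b s) t) with b' by (symmetry; now apply is_derive_unique).
  replace (Derive (fun s => c s) t) with c' by (symmetry; now apply is_derive_unique).
  replace (Derive (fun s => d s) t) with d' by (symmetry; now apply is_derive_unique).
  ring.
Qed.

Lemma overdetermined_system_lambda_symmetry (V : R * R -> Prop)
  (f : R -> R -> R -> R) (F3 F2 F1 F w z phi psi : R -> R -> R) :
  open V -> smooth2 V F3 -> smooth2 V F2 -> smooth2 V F1 -> smooth2 V F ->
  smooth2 V w -> smooth2 V z -> point_transformation V phi psi ->
  cubic_form V f F3 F2 F1 F ->
  overdetermined_system V F3 F2 F1 F w z phi ->
  overdetermined_system V F3 F2 F1 F w z psi ->
  lambda_symmetry V f (lambda1 F3 F2 w z).
Proof.
intros oV S3 S2 S1 S0 Sw Sz T Hf Hphi Hpsi.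
split; [now apply smooth3_lambda1|].
intros x y p Vxy.
(* Taking [y''] to be minus the cubic in the equivalence turns it into a formula for [f]. *)
assert (fE : forall x y p, V (x, y) -> f x y p =
  - (F3 x y * p ^ 3 + F2 x y * p ^ 2 + F1 x y * p + F x y)).
{ intros u v q Vuv. symmetry. apply Hf; trivial. ring. }
assert (dx := fun g Sg => smooth2_is_derive_x V g x y Sg Vxy).
assert (dy := fun g Sg => smooth2_is_derive_y V g x y Sg Vxy).
assert (fy : d_y f x y p =
  - (partial_derive 0 1 F3 x y * p ^ 3 + partial_derive 0 1 F2 x y * p ^ 2
     + partial_derive 0 1 F1 x y * p + partial_derive 0 1 F x y)).
{ unfold d_y. rewrite <- (Derive_opp_cubic _ _ _ _ _ _ _ _ _ _
    (dy F3 S3) (dy F2 S2) (dy F1 S1) (dy F S0)).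
  apply Derive_ext_loc. apply (filter_imp (fun t => V (x, t))).
  - intros t Vt. now apply fE.
  - now apply open_locally_y. }
assert (fp : d_p f x y p = - (3 * F3 x y * p ^ 2 + 2 * F2 x y * p + F1 x y)).
{ transitivity (Derive (fun t =>
    - (F3 x y * t ^ 3 + F2 x y * t ^ 2 + F1 x y * t + F x y)) p).
  { apply Derive_ext. intros t. now apply fE. }
  apply is_derive_unique. auto_derive; [trivial|ring]. }
assert (lx : d_x (lambda1 F3 F2 w z) x y p =
  - partial_derive 1 0 F3 x y * p ^ 2
  - (partial_derive 1 0 F2 x y - partial_derive 1 0 w x y) * p
  - partial_derive 1 0 z x y)
  by exact (Derive_quadratic _ _ _ _ _ p _ _ _ _ (dx F3 S3) (dx F2 S2) (dx w Sw) (dx z Sz)).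
assert (ly : d_y (lambda1 F3 F2 w z) x y p =
  - partial_derive 0 1 F3 x y * p ^ 2
  - (partial_derive 0 1 F2 x y - partial_derive 0 1 w x y) * p
  - partial_derive 0 1 z x y)
  by exact (Derive_quadratic _ _ _ _ _ p _ _ _ _ (dy F3 S3) (dy F2 S2) (dy w Sw) (dy z Sz)).
assert (lp : d_p (lambda1 F3 F2 w z) x y p = - (2 * F3 x y * p + (F2 x y - w x y))).
{ unfold d_p, lambda1. apply is_derive_unique. auto_derive; [trivial|ring]. }
assert (lin : forall g h k, smooth2 V g -> smooth2 V h ->
  partial_derive 1 0 (fun x y => g x y - k * h x y) x y
    = partial_derive 1 0 g x y - k * partial_derive 1 0 h x y /\
  partial_derive 0 1 (fun x y => g x y - k * h x y) x y
    = partial_derive 0 1 g x y - k * partial_derive 0 1 h x y).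
{ intros g h k Sg Sh.
  split; [exact (Derive_minus_scal _ _ _ k _ _ (dx g Sg) (dx h Sh))
         |exact (Derive_minus_scal _ _ _ k _ _ (dy g Sg) (dy h Sh))]. }
assert (opp : forall g, smooth2 V g ->
  partial_derive 1 0 (fun x y => - g x y) x y = - partial_derive 1 0 g x y /\
  partial_derive 0 1 (fun x y => - g x y) x y = - partial_derive 0 1 g x y).
{ intros g Sg.
  split; [exact (Derive_opp (fun t => g t y) x)|exact (Derive_opp (fun t => g x t) y)]. }
assert (S2z : smooth2 V (fun x y => 2 * z x y))
  by (apply (smooth2_mult V (fun _ _ => 2)); trivial; now apply smooth2_const).
assert (S2w : smooth2 V (fun x y => 2 * w x y))
  by (apply (smooth2_mult V (fun _ _ => 2)); trivial; now apply smooth2_const).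
destruct (flat_connection V
  (fun x y => - (F1 x y - 2 * z x y)) F (fun x y => - w x y) z
  (fun x y => - F3 x y) (fun x y => F2 x y - 2 * w x y) phi psi x y)
  as [[Ep2 Ey2] [Ex1 Ex2]]; trivial.
{ apply smooth2_opp; trivial. now apply smooth2_minus. }
{ now apply smooth2_opp. }
{ now apply smooth2_opp. }
{ now apply smooth2_minus. }
{ intros S HS u v Vuv.
  assert (H : overdetermined_system V F3 F2 F1 F w z S)
    by (destruct HS as [->| ->]; trivial).
  destruct (H u v Vuv) as [? [? ?]]. repeat split; lra. }
rewrite (proj2 (opp (fun x y => F1 x y - 2 * z x y) (smooth2_minus V _ _ oV S1 S2z))),
  (proj2 (lin F1 z 2 S1 Sz)), (proj1 (opp w Sw)) in Ex1.
rewrite (proj1 (lin F2 w 2 S2 Sw)) in Ey2.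
rewrite (proj2 (opp w Sw)), (proj1 (opp F3 S3)) in Ep2.
unfold A_field, total_derivative. rewrite lx, ly, lp, fy, fp, (fE x y p Vxy).
unfold lambda1.
(* The powers [p^4] and [p^3] cancel; the coefficients of [p^2] and [1] are single
   curvature components up to sign, and that of [p] is a difference of two. *)
apply Rminus_diag_eq in Ep2. apply Rminus_diag_eq in Ey2.
apply Rminus_diag_eq in Ex1. apply Rminus_diag_eq in Ex2.
apply Rminus_diag_uniq.
match type of Ep2 with ?a = _ => match type of Ey2 with ?b = _ =>
match type of Ex1 with ?c = _ => match type of Ex2 with ?d = _ =>
  transitivity (- a * p ^ 2 + (b - c) * p + d); [ring|rewrite Ep2, Ey2, Ex1, Ex2; ring]
end end end end.
Qed.

(** * Linearizability *)

(** Cramer's rule gives [w] and [z] from the equations for [S_xy]; substituting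
    them, Cramer's rule applied to the other two equations gives the remaining
    coefficients, which are those of the cubic in the numerator of [u_tt]. *)
Lemma overdetermined_system_exists (V : R * R -> Prop) (phi psi : R -> R -> R) :
  open V -> point_transformation V phi psi ->
  exists F3 F2 F1 F w z : R -> R -> R,
    (smooth2 V F3 /\ smooth2 V F2 /\ smooth2 V F1 /\ smooth2 V F /\
     smooth2 V w /\ smooth2 V z) /\
    overdetermined_system V F3 F2 F1 F w z phi /\
    overdetermined_system V F3 F2 F1 F w z psi.
Proof.
intros oV [Sphi [Spsi J0]].
assert (px := smooth2_dx V phi Sphi). assert (py := smooth2_dy V phi Sphi).
assert (qx := smooth2_dx V psi Spsi). assert (qy := smooth2_dy V psi Spsi).
assert (pxx := smooth2_dxx V phi Sphi). assert (qxx := smooth2_dxx V psi Spsi).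
assert (pxy := smooth2_dxy V phi Sphi). assert (qxy := smooth2_dxy V psi Spsi).
assert (pyy := smooth2_dyy V phi Sphi). assert (qyy := smooth2_dyy V psi Spsi).
assert (SJ : smooth2 V (jacobian phi psi))
  by (apply smooth2_minus; trivial; now apply smooth2_mult).
exists
  (fun x y => (partial_derive 0 1 phi x y * partial_derive 0 2 psi x y
               - partial_derive 0 1 psi x y * partial_derive 0 2 phi x y)
              / jacobian phi psi x y),
  (fun x y => (partial_derive 1 0 phi x y * partial_derive 0 2 psi x y
               - partial_derive 1 0 psi x y * partial_derive 0 2 phi x y
               + 2 * (partial_derive 0 1 phi x y * partial_derive 1 1 psi x y
                      - partial_derive 0 1 psi x y * partial_derive 1 1 phi x y))
              / jacobian phi psi x y),
  (fun x y => (partial_derive 0 1 phi x y * partial_derive 2 0 psi x y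
               - partial_derive 0 1 psi x y * partial_derive 2 0 phi x y
               + 2 * (partial_derive 1 0 phi x y * partial_derive 1 1 psi x y
                      - partial_derive 1 0 psi x y * partial_derive 1 1 phi x y))
              / jacobian phi psi x y),
  (fun x y => (partial_derive 1 0 phi x y * partial_derive 2 0 psi x y
               - partial_derive 1 0 psi x y * partial_derive 2 0 phi x y)
              / jacobian phi psi x y),
  (fun x y => (partial_derive 0 1 phi x y * partial_derive 1 1 psi x y
               - partial_derive 0 1 psi x y * partial_derive 1 1 phi x y)
              / jacobian phi psi x y),
  (fun x y => (partial_derive 1 0 phi x y * partial_derive 1 1 psi x y
               - partial_derive 1 0 psi x y * partial_derive 1 1 phi x y)
              / jacobian phi psi x y).
split; [|split].
- assert (B : forall a b c d, smooth2 V a -> smooth2 V b -> smooth2 V c -> smooth2 V d ->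
    smooth2 V (fun x y => a x y * b x y - c x y * d x y)).
  { intros. apply smooth2_minus; trivial; now apply smooth2_mult. }
  assert (C : forall g h, smooth2 V g -> smooth2 V h ->
    smooth2 V (fun x y => g x y + 2 * h x y)).
  { intros g h Sg Sh. apply smooth2_plus; trivial.
    apply (smooth2_mult V (fun _ _ => 2)); trivial. now apply smooth2_const. }
  repeat split; apply smooth2_div; trivial; try (now apply B);
    apply C; now apply B.
- intros x y Vxy. specialize (J0 x y Vxy). unfold jacobian in *.
  repeat split; field; exact J0.
- intros x y Vxy. specialize (J0 x y Vxy). unfold jacobian in *.
  repeat split; field; exact J0.
Qed.

Lemma continuous_zero_off_point (k : R -> R) (p : R) :
  continuous k p -> (forall t, t <> p -> k t = 0) -> k p = 0.
Proof.
intros Ck k0.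
cut (Finite (k p) = Finite 0); [now intros [=]|].
transitivity (Lim k p).
- symmetry. apply is_lim_unique, is_lim_continuity.
  now apply continuity_pt_filterlim.
- apply is_lim_unique, (is_lim_ext_loc (fun _ => 0)); [|apply is_lim_const].
  exists (mkposreal 1 Rlt_0_1). intros t _ Ht. symmetry. now apply k0.
Qed.

(** Two distinct slopes with [D phi = 0] would make the gradient of [phi] vanish. *)
Lemma first_total_nonzero (phi psi : R -> R -> R) (x y p t : R) :
  jacobian phi psi x y <> 0 -> first_total phi x y p = 0 -> t <> p ->
  first_total phi x y t <> 0.
Proof.
unfold jacobian, first_total. intros J0 Hp tp Ht. apply J0.
assert (Hy : partial_derive 0 1 phi x y = 0).
{ apply (Rmult_eq_reg_r (t - p)); [|lra]. lra. }
rewrite Hy in *. replace (partial_derive 1 0 phi x y) with 0 by lra. ring.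
Qed.

(** Linearizability only controls [f] where [D phi] is nonzero; at the one slope
    that this may exclude over each base point, the formula for [f] extends by
    continuity in [y']. *)
Lemma linearizing_cubic_form (V : R * R -> Prop) (f : R -> R -> R -> R)
  (F3 F2 F1 F w z phi psi : R -> R -> R) :
  open V -> smooth3 V f -> point_transformation V phi psi ->
  overdetermined_system V F3 F2 F1 F w z phi ->
  overdetermined_system V F3 F2 F1 F w z psi ->
  (forall x y p q : R, V (x, y) -> first_total phi x y p <> 0 ->
     (u_tt phi psi x y p q = 0 <-> q = f x y p)) ->
  cubic_form V f F3 F2 F1 F.
Proof.
intros oV Sf T Hphi Hpsi L.
assert (K : forall x y p, V (x, y) ->
  f x y p + F3 x y * p ^ 3 + F2 x y * p ^ 2 + F1 x y * p + F x y = 0).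
{ intros x y p Vxy.
  assert (K : forall t, first_total phi x y t <> 0 ->
    f x y t + F3 x y * t ^ 3 + F2 x y * t ^ 2 + F1 x y * t + F x y = 0).
  { intros t Dt.
    apply (overdetermined_system_u_tt V F3 F2 F1 F w z phi psi); trivial.
    now apply L. }
  destruct (Req_dec (first_total phi x y p) 0) as [D0|D0]; [|now apply K].
  apply (continuous_zero_off_point
    (fun t => f x y t + F3 x y * t ^ 3 + F2 x y * t ^ 2 + F1 x y * t + F x y)).
  - apply (ex_derive_continuous (K := R_AbsRing) (V := R_NormedModule)).
    auto_derive. destruct (Sf 1%nat x y p Vxy) as [_ [_ [_ [Hp _]]]]. auto.
  - intros t tp. apply K. apply (first_total_nonzero phi psi x y p); trivial.
    now apply T. }
intros x y p q Vxy. specialize (K x y p Vxy). split; intros H; lra.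
Qed.

Theorem theorem2p1 :
  forall (U : R * R -> Prop) (x0 y0 : R) (f : R -> R -> R -> R),
    open U -> U (x0, y0) -> smooth3 U f ->
    (linearizable U x0 y0 f <->
     exists V : R * R -> Prop,
       open_nbhd_in U V x0 y0 /\
       exists F3 F2 F1 F : R -> R -> R,
         smooth2 V F3 /\ smooth2 V F2 /\ smooth2 V F1 /\ smooth2 V F /\
         cubic_form V f F3 F2 F1 F /\
         exists w z phi psi : R -> R -> R,
           smooth2 V w /\ smooth2 V z /\
           point_transformation V phi psi /\
           lambda_symmetry V f (lambda1 F3 F2 w z) /\
           overdetermined_system V F3 F2 F1 F w z phi /\
           overdetermined_system V F3 F2 F1 F w z psi).
Proof.
intros U x0 y0 f _ _ Sf. split.
- intros [V [phi [psi [[oV [V0 VU]] [T L]]]]].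
  destruct (overdetermined_system_exists V phi psi oV T)
    as [F3 [F2 [F1 [F [w [z [[S3 [S2 [S1 [S0 [Sw Sz]]]]] [Hphi Hpsi]]]]]]]].
  assert (C : cubic_form V f F3 F2 F1 F).
  { apply (linearizing_cubic_form V f F3 F2 F1 F w z phi psi); trivial.
    intros n x y p Vxy. now apply Sf, VU. }
  exists V. split; [now split|].
  exists F3, F2, F1, F. do 5 (split; trivial).
  exists w, z, phi, psi. do 3 (split; trivial). split; [|now split].
  now apply (overdetermined_system_lambda_symmetry V f F3 F2 F1 F w z phi psi).
- intros [V [[oV [V0 VU]] [F3 [F2 [F1 [F [_ [_ [_ [_ [C
    [w [z [phi [psi [_ [_ [T [_ [Hphi Hpsi]]]]]]]]]]]]]]]]]]]].
  exists V, phi, psi. split; [now split|]. split; [exact T|].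
  intros x y p q Vxy D0.
  rewrite (C x y p q Vxy).
  now apply (overdetermined_system_u_tt V F3 F2 F1 F w z phi psi).
Qed.
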